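(* Let $c<b$ be real numbers and let $f:[c,b]\to\mathbb{R}$ be continuous on $[c,b]$ and differentiable on $(c,b)$ with $f'(x)\ge -1$ for every $x\in(c,b)$. Suppose that $f(x)<x$ for each $x\in(c,b]$ and that $c$ is the unique fixed point of $f$ in $[c,b]$. Let $x_0\in(c,b]$ and for each $n\ge 0$ define $$x_{n+1}=\frac{x_n+f(x_n)}{2}.$$ Then the sequence $\{x_n\}$ converges to $c$.
   Context: A fixed point of $f$ is a point $x$ of its domain with $f(x)=x$. The assertion that the recursively defined sequence converges includes that it is well defined, i.e. every $x_n$ lies in the domain $[c,b]$ of $f$. *)

(* Defs.v *)
From HB Require Import structures.
From mathcomp Require Import all_boot all_order all_algebra.
From mathcomp Require Import all_classical all_reals all_analysis.
Set Implicit Arguments.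
Unset Strict Implicit.
Unset Printing Implicit Defensive.
Import Order.TTheory GRing.Theory Num.Theory.
Import numFieldNormedType.Exports.
Local Open Scope classical_set_scope.
Local Open Scope ring_scope.

(* Functions with domain D are represented by total functions of which only
   the values on D matter; fixed points are therefore required to lie in D. *)
Definition fixed_points (T : Type) (D : set T) (f : T -> T) : set T :=
  [set x | D x /\ f x = x].

(* Main.v *)
(* The map T y = (y + f y) / 2 lies below the identity and fixes c; since
   f' >= -1, the mean value theorem gives T y >= c.  Hence the orbit decreases
   and stays in [c, b], and by continuity its limit is a fixed point of f. *)
Require Import Defs.
From mathcomp Require Import all_boot all_order all_algebra.
From mathcomp Require Import all_classical all_reals all_analysis.
From mathcomp Require Import lra.
Set Implicit Arguments.
Unset Strict Implicit.
Unset Printing Implicit Defensive.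
Import Order.TTheory GRing.Theory Num.Theory.
Import numFieldNormedType.Exports.
Local Open Scope classical_set_scope.
Local Open Scope ring_scope.

Lemma mvt_ge_slope (R : realType) (k a b : R) (f : R -> R) :
  a <= b ->
  {within `[a, b], continuous f} ->
  (forall y : R, y \in `]a, b[ -> derivable f y 1) ->
  (forall y : R, y \in `]a, b[ -> k <= derive1 f y) ->
  k * (b - a) <= f b - f a.
Proof.
rewrite le_eqVlt => /predU1P[->|ab] fc fd fk; first by rewrite !subrr mulr0.
have fderive y : y \in `]a, b[ -> is_derive y 1 f (derive1 f y).
  by move=> /fd fy; rewrite derive1E; exact: derivableP.
have [y yab ->] := MVT ab fderive fc.
by rewrite ler_wpM2r ?fk// subr_ge0 ltW.
Qed.

(** Off [A] the total function [f] is arbitrary, so it may be discontinuous at boundary points. A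
    sequence lying in [A] converges to [l] along the trace on [A] of the neighbourhoods of [l],
    where relative continuity suffices. *)
Lemma within_continuous_cvg_seq (R : realType) (A : set R) (f : R -> R)
    (u : nat -> R) (l : R) :
  {within A, continuous f} -> (forall n, A (u n)) -> A l ->
  u n @[n --> \oo] --> l -> f (u n) @[n --> \oo] --> f l.
Proof.
move=> /subspace_continuousP fA Au Al ul.
apply: cvg_trans (fA l Al) => V /ul uV.
by apply: (@filterS _ \oo _ _ _ _ uV) => n; apply.
Qed.

Theorem lemma2p4 (R : realType) (c b : R) (f : R -> R) (x : nat -> R)
  (hcb : c < b)
  (hcont : {within `[c, b], continuous f})
  (hder : forall y : R, y \in `]c, b[ -> derivable f y 1)
  (hder_ge : forall y : R, y \in `]c, b[ -> -1 <= derive1 f y)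
  (hlt : forall y : R, y \in `]c, b] -> f y < y)
  (hfix : fixed_points `[c, b] f = [set c])
  (hx0 : x 0%N \in `]c, b])
  (hxS : forall n : nat, x n.+1 = (x n + f (x n)) / 2) :
  (forall n : nat, x n \in `[c, b]) /\ (x n @[n --> \oo] --> c).
Proof.
have fc : f c = c by have [] : fixed_points `[c, b] f c by rewrite hfix.
have fle y : y \in `[c, b] -> f y <= y.
  rewrite in_itv/= le_eqVlt => /andP[/predU1P[<-|cy] yb]; first by rewrite fc.
  by apply/ltW/hlt; rewrite in_itv/= cy.
have fge y : y \in `[c, b] -> c <= (y + f y) / 2.
  rewrite in_itv/= => /andP[cy yb].
  have sub z : z \in `]c, y[ -> z \in `]c, b[.
    by rewrite !in_itv/= => /andP[-> /lt_le_trans]; apply.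
  (* As [f c = c], this rearranges to [2 * c <= y + f y]. *)
  have : -1 * (y - c) <= f y - f c.
    apply: mvt_ge_slope => // [|z /sub/hder//|z /sub/hder_ge//].
    apply: continuous_subspaceW hcont => z /=.
    by rewrite !in_itv/= => /andP[-> /le_trans]; apply.
  by rewrite fc; lra.
have xcb n : x n \in `[c, b].
  elim: n => [|n xn]; first exact: subset_itv_oc_cc.
  rewrite hxS in_itv/= fge//=.
  by have := fle _ xn; move: xn; rewrite in_itv/= => /andP[]; lra.
split=> //.
have x_dec : nonincreasing_seq x.
  by apply/nonincreasing_seqP => n; rewrite hxS; have := fle _ (xcb n); lra.
have x_cvg : cvgn x.
  apply: nonincreasing_is_cvgn => //; exists c => _ [n _ <-].
  by have := xcb n; rewrite in_itv/= => /andP[].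
(* Membership of the limit is needed twice: for continuity of [f] there, and to count it among the
   fixed points. *)
have lcb : [set` `[c, b]] (limn x).
  apply: (@closed_cvg _ _ \oo _ x) x_cvg; first exact: interval_closed.
  exact: nearW.
have Tl : x n.+1 @[n --> \oo] --> (limn x + f (limn x)) / 2.
  under eq_fun do rewrite hxS.
  apply: cvgMl; apply: cvgD => //.
  exact: within_continuous_cvg_seq hcont xcb lcb x_cvg.
have lT : limn x = (limn x + f (limn x)) / 2.
  have xS : [sequence x n.+1]_n @ \oo --> limn x by rewrite cvg_shiftS.
  exact: cvg_unique xS Tl.
have <- : limn x = c; last exact: x_cvg.
(* Solving [lT] for [f (limn x)] gives [limn x]. *)
have : fixed_points `[c, b] f (limn x) by split=> //; lra.
by rewrite hfix.
Qed.
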